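(* Let $q\geq 2$ be a prime power and let $n\geq 1$. Let $\omega(\mathrm{GL}_n(q))$, $\mathcal{N}_n(q)$ and $\mathcal{A}_n(q)$ be as defined in the context. Then: (a) $\mathrm{GL}_n(q)=\bigcup_{A\in\mathcal{A}_n(q)}A$; (b) $\omega(\mathrm{GL}_n(q))\leq|\mathcal{A}_n(q)|$, with equality if and only if $q>n$; (c) $\mathcal{N}_n(q)\subseteq\mathcal{A}_n(q)$, with equality if and only if $q>n$.
   Context: $\mathrm{GL}_n(q)$ is the group of invertible $n\times n$ matrices over the field $k$ with $q$ elements, acting on $V=k^n$. $\omega(\mathrm{GL}_n(q))$ is the maximum cardinality of a subset $X\subseteq\mathrm{GL}_n(q)$ with $xy\neq yx$ for all distinct $x,y\in X$. An element of $\mathrm{GL}_n(q)$ is cyclic if its characteristic polynomial equals its minimal polynomial, and $\mathcal{N}_n(q)=\{C_{\mathrm{GL}_n(q)}(g)\mid g\text{ cyclic in }\mathrm{GL}_n(q)\}$. For a group $A$ acting $k$-linearly, an $A$-module is indecomposable if it is nonzero and is not the direct sum of two nonzero $A$-submodules. $\mathcal{A}_n(q)$ is the set of abelian subgroups $A$ of $\mathrm{GL}_n(q)$ such that the $A$-module $V$ has a decomposition $V=V_1\oplus\cdots\oplus V_r$ into indecomposable $A$-modules satisfying: (i) $A=A_1\times\cdots\times A_r$, where $A_i\subseteq\mathrm{GL}(V_i)$ (with $A_i$ acting trivially on $V_j$ for $j\neq i$); (ii) for each $i=1,\ldots,r$, $A_i=C_{\mathrm{GL}(V_i)}(a_i)$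 for some $a_i\in\mathrm{GL}(V_i)$ such that $V_i$ is an indecomposable $\langle a_i\rangle$-module. *)

(* Defs.v *)
From HB Require Import structures.
From mathcomp Require Import all_boot all_order all_fingroup all_algebra.
From mathcomp Require Import all_solvable all_character.
From mathcomp Require Import boolp.

Set Implicit Arguments.
Unset Strict Implicit.
Unset Printing Implicit Defensive.

Import GRing.Theory.
Local Open Scope ring_scope.
Local Open Scope group_scope.

(* Maximum size of a set of pairwise non-commuting elements of G. *)
Definition noncommuting (gT : finGroupType) (X : {set gT}) : bool :=
  [forall x in X, forall y in X, (x != y) ==> (x * y != y * x)].

Definition omega (gT : finGroupType) (G : {set gT}) : nat :=
  (\max_(X : {set gT} | (X \subset G) && noncommuting X) #|X|)%N.

(* Companion of [mxsimple]: subspaces are row spaces of square matrices. *)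
Definition mxindecomposable (F : fieldType) (gT : finGroupType)
    (G : {group gT}) (n : nat) (rG : mx_representation F G n) (U : 'M[F]_n) :
    Prop :=
  [/\ mxmodule rG U, (U != 0)%R
    & forall U1 U2 : 'M[F]_n,
        mxmodule rG U1 -> mxmodule rG U2 -> (U1 != 0)%R -> (U2 != 0)%R ->
        mxdirect (U1 + U2)%MS -> ~~ (U1 + U2 == U)%MS].

Section GL.

Variables (F : finFieldType) (n' : nat).
Local Notation n := n'.+1.

(* The index n' of the definitions below stands for dimension n = n'.+1.
   GL_n acts on row vectors by right multiplication. *)
Definition natmod (A : {group {'GL_n[F]}}) :
    mx_representation F A n :=
  subg_repr (GLrepr F n') (subsetT A).

Definition cyclic_elt (g : {'GL_n[F]}) : bool :=
  char_poly (GLval g) == mxminpoly (GLval g).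

Definition calN : {set {group {'GL_n[F]}}} :=
  [set 'C[g]%G | g : {'GL_n[F]} & cyclic_elt g].

(* When k^n is the direct sum of U and W, this is GL(U) embedded in GL_n(k) by
   letting it act trivially on W. *)
Definition GLsummand (U W : 'M[F]_n) : {set {'GL_n[F]}} :=
  rstabs (GLrepr F n') U :&: rstab (GLrepr F n') W.

Definition in_calA (A : {group {'GL_n[F]}}) : Prop :=
  abelian A /\
  exists (r : nat) (V_ : 'I_r -> 'M[F]_n),
    [/\ mxdirect (\sum_i V_ i)%MS,
        (\sum_i V_ i == 1%:M)%MS,
        forall i, mxindecomposable (natmod A) (V_ i)
      & exists A_ : 'I_r -> {group {'GL_n[F]}},
          let GLV i := GLsummand (V_ i) (\sum_(j | j != i) V_ j)%MS in
          [/\ \big[dprod/1]_i A_ i = A,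
              forall i, A_ i \subset GLV i
            & forall i, exists a : {'GL_n[F]},
                [/\ a \in GLV i,
                    mxindecomposable (natmod <[a]>) (V_ i)
                  & A_ i = 'C_(GLV i)[a] :> {set _}]]].

Definition calA : {set {group {'GL_n[F]}}} := [set A | `[< in_calA A >]].

End GL.

Arguments calN F n' : clear implicits.
Arguments calA F n' : clear implicits.

(* Main.v *)
Require Import Defs.
From HB Require Import structures.
From mathcomp Require Import all_boot all_order all_fingroup all_algebra.
From mathcomp Require Import all_solvable all_field all_character.
From mathcomp Require Import boolp.

(** Let V = k^n with n = n'.+1.  For g in GL_n(k), the k[g]-module V is a direct
    sum of indecomposable submodules V_i.  Each V_i is cyclic, isomorphic to
    k[X]/(p_i^e_i) with p_i irreducible ([indec_structure]), so that an
    endomorphism of V_i commuting with g is a polynomial in g.  Consequently the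
    group [stabcent V_ g] of all elements that commute with g and stabilise
    every V_i is abelian; it contains g, and it is the direct product of the
    centralisers of g in the groups GL(V_i) ([dprod_stabcent]).  The members of
    calA are exactly these groups ([stabcent_calA], [calA_stabcent]), so they
    cover GL_n(k).

    Since they are abelian, sending each element to a member of calA that
    contains it is injective on noncommuting sets, whence omega <= #|calA|.

    The element g is cyclic if and only if the polynomials p_i^e_i are pairwise
    coprime ([coprime_cyclic], [cyclic_coprime]); the centraliser of g then
    stabilises every V_i ([coprime_stable]) and is equal to [stabcent V_ g].
    This gives the inclusion of calN in calA.

    Suppose that #|k| > n.  Replacing g by c_i g on V_i, for nonzero scalars
    c_i, does not change [stabcent V_ g].  Over an algebraic closure, choose a
    root a_i of p_i.  One wants p_i and p_j to stay coprime after scaling, that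
    is, c_i a_i should not be a root of the polynomial attached to c_j g on V_j.
    If the c_j are fixed for j < i, at most dim V_j values of c_i are ruled out
    by V_j, hence fewer than n in all; with 0, at most n elements of k are
    forbidden ([separating_scalars]).  So every member of calA is the
    centraliser of a cyclic element and calA = calN.  Picking one such cyclic
    element for each member of calA yields a noncommuting set of size #|calA|:
    two commuting ones lie in each other's abelian centraliser, so these
    centralisers are equal.

    Suppose that #|k| <= n.  The group T of diagonal matrices belongs to calA.
    The n nonzero diagonal entries of x in T cannot be distinct, say
    x_i = x_j with i <> j; then u = 1 + E_ij commutes with x, and y = x u is not
    diagonal although y ^ #|k| = x ([torus_not_maximal]).  So T is not the
    centraliser of x, and T is not in calN.  Moreover any member of calA that
    contains y contains x and differs from T.  A noncommuting set of size
    #|calA| would meet every member of calA in exactly one element; taking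
    for x its element in T, this is contradicted by a member containing y. *)

Set Implicit Arguments.
Unset Strict Implicit.
Unset Printing Implicit Defensive.

Import GRing.Theory.
Local Open Scope ring_scope.

(** * Irreducible factors of polynomials *)

Section PolyFactor.

Variable F : fieldType.
Implicit Types p q s : {poly F}.

Lemma irreducible_factor q :
  (1 < size q)%N -> exists2 p, irreducible_poly p & p %| q.
Proof.
have [n] := ubnP (size q); elim: n q => // n IHn q le_qn q_gt1.
have q0 : q != 0 by rewrite -size_poly_gt0 ltnW.
have [irr|] := pselect (forall d : {poly F}, size d != 1%N -> d %| q -> d %= q).
  by exists q => //; split.
move=> /existsNP[d /not_implyP[d1 /not_implyP[dq /negP ndq]]].
have d0 : d != 0 by apply: contraNneq q0 => d0; rewrite -dvd0p -d0.
have d_gt1 : (1 < size d)%N by rewrite ltn_neqAle eq_sym d1 size_poly_gt0.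
have ltdq : (size d < size q)%N.
  by rewrite ltn_neqAle dvdp_leq // andbT (dvdp_size_eqp dq).
have [p irr_p pd] := IHn d (leq_trans ltdq le_qn) d_gt1.
by exists p => //; apply: dvdp_trans dq.
Qed.

Lemma irredp_coprime p s : irreducible_poly p -> ~~ (p %| s) -> coprimep p s.
Proof.
move=> irr_p nps; apply/coprimepP => d dp ds.
have [//|dp'] := irredp_XsubCP irr_p dp.
by rewrite -(eqp_dvdl s dp') ds in nps.
Qed.

Lemma irredp_part p s : (1 < size p)%N -> s != 0 ->
  exists j s', s = p ^+ j * s' /\ ~~ (p %| s').
Proof.
move=> p_gt1; have [n] := ubnP (size s); elim: n s => // n IHn s le_sn s0.
have [/dvdpP[t Es]|nps] := boolP (p %| s); last first.
  by exists 0%N, s; rewrite expr0 mul1r.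
have t0 : t != 0 by apply: contraNneq s0 => t0; rewrite Es t0 mul0r.
have p0 : p != 0 by rewrite -size_poly_gt0 ltnW.
have lt_ts : (size t < size s)%N.
  rewrite Es size_mul // -subn1 -addnBA; last by rewrite ltnW.
  by rewrite -[X in (X < _)%N]addn0 ltn_add2l subn_gt0.
have [j [s' [Et nps']]] := IHn t (leq_trans lt_ts le_sn) t0.
by exists j.+1, s'; split=> //; rewrite Es Et exprSr mulrAC.
Qed.

End PolyFactor.

Lemma dvdp_prod_coprime (F : fieldType) (I : finType) (m : I -> {poly F}) q :
    (forall i j, i != j -> coprimep (m i) (m j)) -> (forall i, m i %| q) ->
  \prod_i m i %| q.
Proof.
move=> cm mq; have := index_enum_uniq I; elim: (index_enum I) => [|i s IHs] /=.
  by rewrite big_nil dvd1p.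
move=> /andP[nis us]; rewrite big_cons Gauss_dvdp ?mq ?IHs //.
rewrite big_seq; apply: (big_ind (fun p => coprimep (m i) p)).
- exact: coprimep1.
- by move=> p1 p2 c1 c2; rewrite coprimepMr c1.
by move=> j sj; apply: cm; apply: contraNneq nis => ->.
Qed.

(** * Indecomposable modules over k[g] are cyclic *)

Section Indecomposable.

Variables (F : fieldType) (n' : nat).
Local Notation n := n'.+1.
Implicit Types (g h U W : 'M[F]_n) (p q s : {poly F}).

(** The row space of U is an indecomposable k[g]-module; this is
    [mxindecomposable] for the group generated by g, stated for a matrix g that
    need not be invertible. *)
Definition indec g U : Prop :=
  [/\ stablemx U g, U != 0
    & forall U1 U2 : 'M[F]_n, stablemx U1 g -> stablemx U2 g ->
        U1 != 0 -> U2 != 0 -> mxdirect (U1 + U2)%MS -> ~~ (U1 + U2 == U)%MS].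

(** The annihilator of the rows of W in k[X] is a nonzero principal ideal. *)
Lemma annihilator_gen g k (W : 'M_(k, n)) :
  exists2 m, m != 0 & forall s, W *m horner_mx g s = 0 <-> m %| s.
Proof.
pose P k := `[< exists s, [/\ s != 0, size s = k & W *m horner_mx g s = 0] >].
have exP : exists k, P k.
  exists (size (mxminpoly g)); apply/asboolP; exists (mxminpoly g).
  by rewrite mx_root_minpoly mulmx0 monic_neq0 // mxminpoly_monic.
have [_ /asboolP[m [m0 <- Wm]] min_m] := ex_minnP exP.
exists m => // s; split=> [Ws|/dvdpP[t ->]]; last first.
  by rewrite mulrC rmorphM /= -mulmxE mulmxA Wm mul0mx.
have Wr : W *m horner_mx g (s %% m) = 0.
  move: Ws; rewrite {1}(divp_eq s m) rmorphD mulrC rmorphM /= mulmxDr.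
  by rewrite -mulmxE mulmxA Wm mul0mx add0r.
rewrite /dvdp; apply: contraPT (ltn_modp s m) => r0; rewrite m0 /=.
by apply/negP; rewrite -leqNgt min_m //; apply/asboolP; exists (s %% m).
Qed.

Lemma mulmx_hornerM g p q k (W : 'M_(k, n)) :
  W *m horner_mx g (p * q) = W *m horner_mx g p *m horner_mx g q.
Proof. by rewrite rmorphM /= -mulmxE mulmxA. Qed.

(** If the annihilator of U contained p q without containing p or q, then U
    would split as U p(g) + U q(g), by a Bezout relation. *)
Lemma indec_coprime g U p q : indec g U -> coprimep p q ->
  U *m horner_mx g (p * q) = 0 ->
  U *m horner_mx g p = 0 \/ U *m horner_mx g q = 0.
Proof.
move=> [Ug _ indU] cpq Upq.
have [/eqP|Up0] := boolP (U *m horner_mx g p == 0); first by left.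
have [/eqP|Uq0] := boolP (U *m horner_mx g q == 0); first by right.
have st s : stablemx (U *m horner_mx g s) g.
  rewrite -mulmxA (comm_horner_mx s (comm_mx_refl g)).
  by rewrite mulmxA submxMr.
have [[a b] /= Eab] := Bezout_eq1_coprimepP _ _ cpq.
have kp : U *m horner_mx g p *m horner_mx g q = 0 by rewrite -mulmx_hornerM.
have kq : U *m horner_mx g q *m horner_mx g p = 0.
  by rewrite -mulmx_hornerM mulrC.
have dx : mxdirect (U *m horner_mx g p + U *m horner_mx g q).
  apply/mxdirect_addsP/eqP; rewrite -submx0.
  set W := (_ :&: _)%MS.
  have Wp : W *m horner_mx g q = 0.
    by apply/eqP; rewrite -submx0 -kp submxMr ?capmxSl.
  have Wq : W *m horner_mx g p = 0.
    by apply/eqP; rewrite -submx0 -kq submxMr ?capmxSr.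
  rewrite -[W]mulmx1 -[1%:M](horner_mx_C g) -[1%:P]Eab rmorphD /= mulmxDr.
  by rewrite ![_ * p]mulrC ![_ * q]mulrC !mulmx_hornerM Wp Wq !mul0mx addr0.
have /negP[] := indU _ _ (st p) (st q) Up0 Uq0 dx.
rewrite addsmx_sub !horner_mx_stable //=.
rewrite -{1}[U]mulmx1 -[1%:M](horner_mx_C g) -[1%:P]Eab rmorphD /= mulmxDr.
by rewrite !mulmx_hornerM addmx_sub_adds ?submxMr ?horner_mx_stable.
Qed.

Lemma indec_primary g U : indec g U -> exists p e, irreducible_poly p /\
  forall s, U *m horner_mx g s = 0 <-> p ^+ e %| s.
Proof.
move=> indU; have [_ U0 _] := indU.
have [m m0 annU] := annihilator_gen g U.
have m_gt1 : (1 < size m)%N.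
  rewrite ltn_neqAle size_poly_gt0 m0 andbT eq_sym.
  apply: contra U0 => m1; apply/eqP; rewrite -[U]mulmx1 -[1%:M](horner_mx_C g).
  by apply/annU; rewrite dvdUp // -size_poly_eq1.
have [p irr_p pm] := irreducible_factor m_gt1.
have [j [s [Em nps]]] := irredp_part irr_p.1 m0.
have cps : coprimep (p ^+ j) s by rewrite coprimep_expl // irredp_coprime.
exists p, j; split=> // s1.
have [] := indec_coprime indU cps.
- by apply/annU; rewrite -Em.
- move=> /annU mp; have mpj : m %= p ^+ j by rewrite /eqp mp Em dvdp_mulIl.
  by rewrite -(eqp_dvdl _ mpj).
by move/annU/(dvdp_trans pm); rewrite (negPf nps).
Qed.

(** A row of U that is not killed by p^(e-1)(g) has annihilator (p^e). *)
Lemma primary_vector g U p e : irreducible_poly p -> U != 0 ->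
    (forall s, U *m horner_mx g s = 0 <-> p ^+ e %| s) ->
  exists2 v : 'rV_n, (v <= U)%MS
    & forall s, v *m horner_mx g s = 0 <-> p ^+ e %| s.
Proof.
move=> irr_p U0 annU.
case: e annU => [|e] annU.
  by case/eqP: U0; rewrite -[U]mulmx1 -[1%:M](horner_mx_C g); apply/annU.
have Upe : U *m horner_mx g (p ^+ e) != 0.
  apply/eqP => /annU; rewrite dvdp_Pexp2l ?ltnn //; exact: irr_p.1.
have [i vpe] : exists i, row i U *m horner_mx g (p ^+ e) != 0.
  apply/existsP; apply: contraR Upe; rewrite negb_exists => /forallP Upe.
  apply/eqP/row_matrixP=> i; rewrite row_mul row0; apply/eqP.
  by have := Upe i; rewrite negbK.
exists (row i U); first exact: row_sub.
set v := row i U in vpe * => s; split=> [vs|/annU Us]; last first.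
  by rewrite /v -row_mul Us row0.
have [->|s0] := eqVneq s 0; first exact: dvdp0.
have [j [s' [Es nps']]] := irredp_part irr_p.1 s0.
have [lt_ej|le_je] := ltnP e j.
  by rewrite Es dvdp_mulr // dvdp_exp2l.
have := irredp_coprime irr_p nps'; move/(coprimep_expl e.+1).
move/Bezout_eq1_coprimepP => [[a b] /= Eab].
have vp : v *m horner_mx g (p ^+ e.+1) = 0.
  by rewrite /v -row_mul (annU _).2 // row0.
case/eqP: vpe; rewrite -(subnKC le_je) exprD mulmx_hornerM.
have -> : p ^+ j = p ^+ e.+1 * (a * p ^+ j) + s * b.
  by rewrite -[LHS]mulr1 -Eab mulrDr Es; congr (_ + _);
     [rewrite mulrC mulrCA mulrA mulrC mulrCA | rewrite mulrAC mulrA].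
by rewrite rmorphD /= mulmxDr !mulmx_hornerM vp vs !mul0mx addr0 mul0mx.
Qed.

(** A vector v whose annihilator is that of U generates U: the submodule
    v k[g] always has a stable complement, namely the largest submodule of U in
    the kernel of a linear form that kills v g^i for i < d and not v g^d, where
    d + 1 is the degree of the annihilator. *)
Lemma indec_cyclic g U (m : {poly F}) (v : 'rV_n) :
    indec g U -> m != 0 -> (v <= U)%MS ->
    (forall s, U *m horner_mx g s = 0 <-> m %| s) ->
    (forall s, v *m horner_mx g s = 0 <-> m %| s) ->
  size m = (\rank U).+1 /\
  forall w : 'rV_n, (w <= U)%MS -> exists s, w = v *m horner_mx g s.
Proof.
move=> [Ug U0 indU] m0 vU annU annv.
have [d Ed] : exists d, size m = d.+2.
  have : (size m != 1)%N.
    apply: contra U0 => m1; apply/eqP.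
    rewrite -[U]mulmx1 -[1%:M](horner_mx_C g); apply/annU.
    by rewrite dvdUp // -size_poly_eq1.
  have : (0 < size m)%N by rewrite size_poly_gt0.
  by case: (size m) => [|[|d]] //; exists d.
pose B : 'M_(d.+1, n) := \matrix_(i < d.+1) (v *m g ^+ i).
have BE u : u *m B = v *m horner_mx g (rVpoly u).
  rewrite mulmx_sum_row [rVpoly u]poly_def linear_sum /= mulmx_sumr.
  apply: eq_bigr => i _; rewrite rowK valK linearZ /= -scalemxAr.
  by rewrite rmorphXn /= horner_mx_X.
have freeB : row_free B.
  apply: inj_row_free => u; rewrite BE => /annv mu.
  apply/eqP; rewrite -[u]rVpolyK; apply/eqP.
  suff -> : rVpoly u = 0 by rewrite linear0.
  apply/eqP; apply: contraTT (size_poly d.+1 _) => u0.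
  by rewrite -ltnNge -Ed; apply: dvdp_leq mu.
have Bsub s : (v *m horner_mx g s <= B)%MS.
  rewrite (divp_eq s m) rmorphD /= mulmxDr [_ * m]mulrC mulmx_hornerM.
  rewrite (annv m).2 // mul0mx add0r -(@poly_rV_K _ d.+1 (s %% m)).
    by rewrite -BE submxMl.
  by rewrite -ltnS -Ed ltn_modp.
have BU : (B <= U)%MS.
  apply/row_subP=> i; rewrite rowK (submx_trans (submxMr _ vU)) //.
  by rewrite -[g]horner_mx_X -rmorphXn horner_mx_stable.
have Bg : stablemx B g.
  apply/row_subP=> i; rewrite row_mul rowK -mulmxA.
  have -> : g ^+ i *m g = horner_mx g 'X^(i.+1).
    by rewrite rmorphXn /= horner_mx_X exprSr.
  exact: Bsub.
have [phi phiE] : exists phi : 'cV_n, forall t : {poly F}, (size t <= d.+1)%N ->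
    v *m horner_mx g t *m phi = (t`_d)%:M.
  exists (col ord_max (pinvmx B)) => t le_td.
  rewrite -(poly_rV_K le_td) -BE -mulmxA colE [B *m _]mulmxA mulmxVp //.
  rewrite mul1mx -colE; apply/matrixP=> i j.
  by rewrite !ord1 !mxE poly_rV_K.
(* The columns of C are the linear forms w |-> phi (w g^j), for j <= d. *)
pose C : 'M_(n, d.+1) := \matrix_(i, j) (horner_mx g ('X ^+ j) *m phi) i 0.
pose W := (U :&: kermx C)%MS.
have WP (w : 'rV_n) : (w <= W)%MS <->
    (w <= U)%MS /\ forall s, w *m horner_mx g s *m phi = 0.
  rewrite sub_capmx; split=> [/andP[wU /sub_kermxP wC]|[wU ws]]; last first.
    rewrite wU; apply/sub_kermxP/matrixP=> i j; rewrite !ord1 !mxE.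
    have /matrixP/(_ 0 0) := ws ('X ^+ j); rewrite -mulmxA !mxE => E0.
    rewrite -[RHS]E0.
    by apply: eq_bigr => k _; rewrite !mxE.
  split=> // s; rewrite (divp_eq s m) rmorphD /= mulmxDr [_ * m]mulrC.
  have -> : w *m horner_mx g (m * (s %/ m)) = 0.
    apply/eqP; rewrite mulmx_hornerM -submx0.
    by rewrite (submx_trans (submxMr _ (submxMr _ wU))) // (annU m).2 // mul0mx.
  rewrite add0r.
  have: (size (s %% m)%R <= d.+1)%N by rewrite -ltnS -Ed ltn_modp.
  move=> le_td; rewrite -(poly_rV_K le_td) [rVpoly _]poly_def linear_sum.
  rewrite mulmx_sumr mulmx_suml big1 // => i _.
  rewrite valK linearZ /= -scalemxAr -scalemxAl -mulmxA.
  have -> : w *m (horner_mx g 'X^i *m phi) = 0; last by rewrite scaler0.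
  apply/matrixP=> a b; rewrite !ord1.
  have /matrixP/(_ 0 i) := wC; rewrite !mxE => E0; rewrite -[RHS]E0.
  by apply: eq_bigr => k _; rewrite !mxE.
have Wg : stablemx W g.
  apply/row_subP=> i; rewrite row_mul; apply/WP.
  have [wU ws] := (WP (row i W)).1 (row_sub i W).
  split=> [|s]; first exact: submx_trans (submxMr _ wU) Ug.
  by rewrite -{1}[g]horner_mx_X -mulmx_hornerM ws.
have dxBW : (<<B>> :&: W)%MS = 0.
  apply/eqP; rewrite -submx0; apply/rV_subP=> x; rewrite sub_capmx genmxE.
  move=> /andP[/submxP[u Ex] /WP[_ xs]].
  have [t0|t0] := eqVneq (rVpoly u) 0.
    by rewrite Ex BE t0 rmorph0 mulmx0 sub0mx.
  have szt : (0 < size (rVpoly u) <= d.+1)%N.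
    by rewrite size_poly_gt0 t0 size_poly.
  (* The product t of rVpoly u by a power of X has its leading coefficient in
     degree d, where phi detects it. *)
  have le_k : (d.+1 - size (rVpoly u) + size (rVpoly u) = d.+1)%N.
    by rewrite subnK; case/andP: szt.
  pose t := rVpoly u * 'X^(d.+1 - size (rVpoly u)).
  have szt' : size t = d.+1 by rewrite /t size_mulXn // le_k.
  have := phiE t; rewrite szt' leqnn => /(_ isT).
  have -> : v *m horner_mx g t *m phi = 0 by rewrite mulmx_hornerM -BE -Ex xs.
  move/matrixP/(_ 0 0); rewrite !mxE eqxx mulr1n => /esym/eqP.
  have -> : t`_d = lead_coef t by rewrite lead_coefE szt'.
  by rewrite lead_coef_eq0 -size_poly_eq0 szt'.
have rkBW : (\rank U <= d.+1 + \rank W)%N.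
  rewrite -(mxrank_mul_ker U C) leq_add2r.
  exact: leq_trans (mxrankM_maxr _ _) (rank_leq_col _).
have rkB : \rank <<B>>%MS = d.+1 by rewrite genmxE; apply/eqP.
have rkS : \rank (<<B>> + W)%MS = (d.+1 + \rank W)%N.
  by rewrite mxrank_disjoint_sum ?rkB.
have sBW : (<<B>> + W <= U)%MS by rewrite addsmx_sub genmxE BU capmxSl.
have W0 : W = 0.
  apply/eqP; apply: contraT => W0.
  have /negP[] : ~~ (<<B>> + W == U)%MS.
    apply: indU => //; first by rewrite (eqmx_stable _ (genmxE B)).
      by rewrite -mxrank_eq0 rkB.
    by apply/mxdirect_addsP.
  by rewrite sBW -(geq_leqif (mxrank_leqif_sup sBW)) rkS.
have UB : (U <= B)%MS.
  have := geq_leqif (mxrank_leqif_sup sBW); rewrite rkS rkBW W0.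
  by rewrite addsmx0 genmxE => <-.
split.
  rewrite Ed -rkB genmxE; congr _.+1.
  by apply/eqP; rewrite eqn_leq !mxrankS.
move=> w wU; have /submxP[u ->] := submx_trans wU UB.
by exists (rVpoly u).
Qed.

(** An indecomposable k[g]-module is isomorphic to k[X]/(p^e), p irreducible. *)
Lemma indec_structure g U : indec g U -> exists p e,
  [/\ irreducible_poly p,
      forall s, U *m horner_mx g s = 0 <-> p ^+ e %| s,
      size (p ^+ e) = (\rank U).+1
    & exists2 v : 'rV_n, (v <= U)%MS
        & forall w : 'rV_n, (w <= U)%MS -> exists s, w = v *m horner_mx g s].
Proof.
move=> indU; have [p [e [irr_p annU]]] := indec_primary indU.
have [_ U0 _] := indU; have [v vU annv] := primary_vector irr_p U0 annU.
have pe0 : p ^+ e != 0 by rewrite expf_neq0 // irredp_neq0.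
have [szU genU] := indec_cyclic indU pe0 vU annU annv.
by exists p, e; split=> //; exists v.
Qed.

(** As U is generated by one vector v, the action of h is determined by v h,
    which has the form v s(g). *)
Lemma indec_centralizer g h U : indec g U -> stablemx U h -> comm_mx g h ->
  exists s, U *m h = U *m horner_mx g s.
Proof.
move=> indU Uh cgh; have [p [e [_ _ _ [v vU genU]]]] := indec_structure indU.
have [t Et] := genU _ (submx_trans (submxMr h vU) Uh).
exists t; apply/row_matrixP=> i; rewrite !row_mul.
have [s ->] := genU _ (row_sub i U).
rewrite -mulmxA -(comm_mx_horner s (comm_mx_sym cgh)) mulmxA Et -!mulmxA.
by congr (_ *m _); apply: comm_horner_mx2.
Qed.

(** Expressed in this way, the agreement of X and Y on U passes to subspaces
    and to sums. *)
Lemma eq_mulmxP m (U : 'M_(m, n)) (X Y : 'M[F]_n) :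
  U *m X = U *m Y <-> (U <= kermx (X - Y))%MS.
Proof.
split=> [E|/sub_kermxP/eqP]; first by apply/sub_kermxP; rewrite mulmxBr E subrr.
by rewrite mulmxBr subr_eq0 => /eqP.
Qed.

Lemma eq_mulmx_sub m1 m2 (W : 'M_(m1, n)) (U : 'M_(m2, n)) (X Y : 'M[F]_n) :
  (W <= U)%MS -> U *m X = U *m Y -> W *m X = W *m Y.
Proof. by move=> WU /eq_mulmxP UXY; apply/eq_mulmxP/(submx_trans WU). Qed.

Lemma indec_commute g h k U : indec g U -> stablemx U h -> stablemx U k ->
  comm_mx g h -> comm_mx g k -> U *m (h *m k) = U *m (k *m h).
Proof.
move=> indU Uh Uk cgh cgk.
have [s Es] := indec_centralizer indU Uh cgh.
have [t Et] := indec_centralizer indU Uk cgk.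
rewrite !mulmxA (eq_mulmx_sub Uh Et) (eq_mulmx_sub Uk Es) Es Et -!mulmxA.
by congr (_ *m _); apply: comm_horner_mx2.
Qed.

(** * Decompositions into indecomposable summands *)

Lemma indec_decomposition g U : stablemx U g ->
  exists r (V_ : 'I_r -> 'M_n), [/\ mxdirect (\sum_i V_ i)%MS,
    (\sum_i V_ i :=: U)%MS & forall i, indec g (V_ i)].
Proof.
have [k] := ubnP (\rank U); elim: k U => // k IHk U le_Uk Ug.
have [->|U0] := eqVneq U 0.
  exists 0%N, (fun _ => 0); split=> [||[]//]; last by rewrite big_ord0.
  by apply/mxdirectP; rewrite /= !big_ord0 mxrank0.
have [indU|nindU] := pselect (indec g U).
  exists 1%N, (fun _ => U); split=> //; last by rewrite big_ord1.
  by apply/mxdirectP; rewrite /= !big_ord1.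
have [U1 [U2 [U1g U2g U10 U20 [dxU /eqmxP EU]]]] : exists U1 U2 : 'M_n,
    [/\ stablemx U1 g, stablemx U2 g, U1 != 0, U2 != 0
      & mxdirect (U1 + U2)%MS /\ (U1 + U2 == U)%MS].
  apply: contra_notP nindU => nex; split=> // U1 U2 U1g U2g U10 U20 dx.
  by apply/negP => E; apply: nex; exists U1, U2.
have rkU : (\rank U1 + \rank U2 = \rank U)%N by rewrite -EU (mxdirectP dxU).
have lt_U1 : (\rank U1 < \rank U)%N.
  by rewrite -rkU -[X in (X < _)%N]addn0 ltn_add2l lt0n mxrank_eq0.
have lt_U2 : (\rank U2 < \rank U)%N.
  by rewrite -rkU -[X in (X < _)%N]add0n ltn_add2r lt0n mxrank_eq0.
have [r1 [V1 [dx1 E1 ind1]]] := IHk U1 (leq_trans lt_U1 le_Uk) U1g.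
have [r2 [V2 [dx2 E2 ind2]]] := IHk U2 (leq_trans lt_U2 le_Uk) U2g.
pose V_ (i : 'I_(r1 + r2)) :=
  match split i with inl j => V1 j | inr j => V2 j end.
have Vl j : V_ (lshift r2 j) = V1 j.
  by rewrite /V_ (unsplitK (inl j : 'I_r1 + 'I_r2)%type).
have Vr j : V_ (rshift r1 j) = V2 j.
  by rewrite /V_ (unsplitK (inr j : 'I_r1 + 'I_r2)%type).
have EV : (\sum_i V_ i :=: U)%MS.
  rewrite big_split_ord /= (eq_bigr _ (fun j _ => Vl j)).
  rewrite (eq_bigr _ (fun j _ => Vr j)).
  exact: eqmx_trans (adds_eqmx E1 E2) EU.
exists (r1 + r2)%N, V_; split=> //; last first.
  by move=> i; rewrite /V_; case: (split i).
apply/mxdirectP; rewrite /= EV -rkU big_split_ord /=.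
rewrite (eq_bigr _ (fun j _ => congr1 mxrank (Vl j))).
rewrite (eq_bigr _ (fun j _ => congr1 mxrank (Vr j))).
by rewrite -E1 -E2 (mxdirectP dx1) (mxdirectP dx2).
Qed.

Section Glue.

Variables (r : nat) (V_ : 'I_r -> 'M[F]_n).
Hypothesis dxV : mxdirect (\sum_i V_ i)%MS.

(** Matrices acting on the summands of a direct sum can be glued together. *)
Lemma glue_mx (X_ : 'I_r -> 'M[F]_n) :
  exists X : 'M[F]_n, forall i, V_ i *m X = V_ i *m X_ i.
Proof.
pose pi i := proj_mx (V_ i) (\sum_(j | j != i) V_ j)%MS.
have dx i := mxdirect_sumsP dxV i isT.
exists (\sum_i pi i *m X_ i) => i; rewrite mulmx_sumr (bigD1 i) //= big1 ?addr0.
  by rewrite mulmxA proj_mx_id.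
by move=> j ji; rewrite mulmxA proj_mx_0 ?mul0mx ?(sumsmx_sup i) // eq_sym.
Qed.

Lemma eq_mulmx_sum (P : pred 'I_r) (X Y : 'M[F]_n) :
  (forall i, P i -> V_ i *m X = V_ i *m Y) ->
  (\sum_(i | P i) V_ i)%MS *m X = (\sum_(i | P i) V_ i)%MS *m Y.
Proof.
by move=> EXY; apply/eq_mulmxP/sumsmx_subP=> i Pi; apply/eq_mulmxP/EXY.
Qed.

Hypothesis sumV : (\sum_i V_ i == 1%:M)%MS.

Lemma eq_mx_on_summands (X Y : 'M[F]_n) :
  (forall i, V_ i *m X = V_ i *m Y) -> X = Y.
Proof.
move=> EXY; rewrite -[X]mul1mx -[Y]mul1mx.
have /andP[_ s1V] := sumV; apply: eq_mulmx_sub s1V _.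
by apply: eq_mulmx_sum => i _; apply: EXY.
Qed.

End Glue.

End Indecomposable.

(** * The members of calA *)

Section GL.

Variables (F : finFieldType) (n' : nat).
Local Notation n := n'.+1.
Local Notation GL := {'GL_n[F]}.
Implicit Types (g h x y : GL) (A : {group GL}).

Lemma mem_GLrstabs (U : 'M[F]_n) g :
  (g \in rstabs (GLrepr F n') U) = stablemx U (GLval g).
Proof. by rewrite !inE. Qed.

Lemma mxmodule_natmod A (U : 'M[F]_n) :
  reflect (forall h, h \in A -> stablemx U (GLval h)) (mxmodule (natmod A) U).
Proof.
apply: (iffP subsetP) => UA h Ah; last by rewrite inE Ah UA.
by have := UA h Ah; rewrite inE => /andP[].
Qed.

Lemma mxmodule_cycle g (U : 'M[F]_n) :
  mxmodule (natmod <[g]>) U = stablemx U (GLval g).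
Proof.
apply/mxmodule_natmod/idP=> [-> //|Ug h]; first exact: cycle_id.
by rewrite -mem_GLrstabs; apply/subsetP; rewrite cycle_subG mem_GLrstabs.
Qed.

Lemma mxindec_cycle g (U : 'M[F]_n) :
  mxindecomposable (natmod <[g]>) U <-> indec (GLval g) U.
Proof.
rewrite /mxindecomposable /indec mxmodule_cycle.
by split=> -[Ug U0 ind]; split=> // U1 U2; have := ind U1 U2;
  rewrite !mxmodule_cycle.
Qed.

Lemma mxindec_sup g A (U : 'M[F]_n) : g \in A -> mxmodule (natmod A) U ->
  indec (GLval g) U -> mxindecomposable (natmod A) U.
Proof.
move=> Ag UA [Ug U0 ind].
split=> // U1 U2 /mxmodule_natmod U1A /mxmodule_natmod U2A.
by apply: ind; [apply: U1A | apply: U2A].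
Qed.

Lemma GLval_inj : injective (@GLval n F). Proof. exact: val_inj. Qed.

Lemma GLvalM g h : GLval (g * h)%g = (GLval g : 'M[F]_n) *m GLval h.
Proof. by []. Qed.

Lemma GLsummandP (U W : 'M[F]_n) g :
  reflect (stablemx U (GLval g) /\ W *m GLval g = W) (g \in GLsummand U W).
Proof.
rewrite in_setI mem_GLrstabs inE in_setT /=.
by apply: (iffP andP) => -[-> /eqP].
Qed.

Lemma GLcommP g h : reflect (comm_mx (GLval g) (GLval h)) (g \in 'C[h]%g).
Proof.
by apply: (iffP cent1P) => [/(congr1 (@GLval n F))|E]; last exact: GLval_inj.
Qed.

(** The group of all elements of GL_n that commute with g and stabilise every
    V_i. *)
Definition stabcent r (V_ : 'I_r -> 'M[F]_n) g : {group GL} :=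
  ('C[g] :&: \bigcap_i rstabs_group (GLrepr F n') (V_ i))%G.

Lemma stabcentP r (V_ : 'I_r -> 'M[F]_n) g h :
  reflect (comm_mx (GLval h) (GLval g) /\ forall i, stablemx (V_ i) (GLval h))
          (h \in stabcent V_ g).
Proof.
rewrite inE; apply: (iffP andP) => [[/GLcommP chg /bigcapP hV]|[chg hV]].
  by split=> // i; have := hV i isT; rewrite mem_GLrstabs.
by split; [apply/GLcommP | apply/bigcapP=> i _; rewrite /= mem_GLrstabs].
Qed.

Section Decomposition.

Variables (r : nat) (V_ : 'I_r -> 'M[F]_n).
Hypothesis dxV : mxdirect (\sum_i V_ i)%MS.
Hypothesis sumV : (\sum_i V_ i == 1%:M)%MS.

Lemma GL_eq_on_summands g h :
  (forall i, V_ i *m GLval g = V_ i *m GLval h) -> g = h.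
Proof. by move=> E; apply/GLval_inj/(eq_mx_on_summands sumV). Qed.

Lemma glue_GL (h_ : 'I_r -> GL) : (forall i, stablemx (V_ i) (GLval (h_ i))) ->
  exists g, forall i, V_ i *m GLval g = V_ i *m GLval (h_ i).
Proof.
move=> hV; have [X XE] := glue_mx dxV (fun i => GLval (h_ i)).
have [Y YE] := glue_mx dxV (fun i => GLval ((h_ i)^-1)%g).
have XY : X *m Y = 1%:M.
  apply: (eq_mx_on_summands sumV) => i.
  by rewrite mulmxA XE (eq_mulmx_sub (hV i) (YE i)) -mulmxA -GLvalM mulgV.
have uX : X \is a GRing.unit by case/mulmx1_unit: XY.
by exists (Sub X uX).
Qed.

Lemma summand_fixP i g :
  (\sum_(j | j != i) V_ j)%MS *m GLval g = (\sum_(j | j != i) V_ j)%MS <->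
  (forall j, j != i -> V_ j *m GLval g = V_ j).
Proof.
split=> [E j ji|E]; rewrite -[RHS]mulmx1.
  by apply: (@eq_mulmx_sub _ _ _ _ _ (\sum_(j | j != i) V_ j)%MS);
    rewrite ?mulmx1 // (sumsmx_sup j).
by apply: eq_mulmx_sum => j ji; rewrite mulmx1 E.
Qed.

Let GLV i := GLsummand (V_ i) (\sum_(j | j != i) V_ j)%MS.

(** If g acts as a_i on V_i, then [stabcent V_ g] is the direct product of the
    centralisers of the a_i in the groups GL(V_i). *)
Lemma dprod_stabcent (a_ : 'I_r -> GL) (A_ : 'I_r -> {group GL}) g :
    (forall i, a_ i \in GLV i) ->
    (forall i, A_ i = 'C_(GLV i)[a_ i]%g :> {set GL}) ->
    (forall i, V_ i *m GLval g = V_ i *m GLval (a_ i)) ->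
  \big[dprod/1%g]_i A_ i = stabcent V_ g.
Proof.
move=> aP AE gE.
have aV i : stablemx (V_ i) (GLval (a_ i)) by case/GLsummandP: (aP i).
have gV i : stablemx (V_ i) (GLval g) by rewrite gE.
have a1 i j : j != i -> V_ j *m GLval (a_ i) = V_ j.
  by case/GLsummandP: (aP i) => _ /summand_fixP; apply.
have AP i x : x \in A_ i <-> [/\ stablemx (V_ i) (GLval x),
    forall j, j != i -> V_ j *m GLval x = V_ j
    & comm_mx (GLval x) (GLval (a_ i))].
  rewrite AE inE; split.
    by move=> /andP[/GLsummandP[xV /summand_fixP x1] /GLcommP cx].
  case=> xV x1 cx; apply/andP; split; last exact/GLcommP.
  by apply/GLsummandP; split=> //; apply/summand_fixP.
have Ast i x l : x \in A_ i -> stablemx (V_ l) (GLval x).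
  by case/AP=> xV x1 _; have [->//|li] := eqVneq l i; rewrite x1.
have dxA : \big[dprod/1%g]_i A_ i = (\prod_i A_ i)%G.
  apply/eqP/bigdprodYP => i _.
  (* The product of the A_j for j != i lies in the group K of the elements
     that fix V_i pointwise and stabilise every V_l. *)
  set K := (rstab_group (GLrepr F n') (V_ i)
             :&: \bigcap_l rstabs_group (GLrepr F n') (V_ l))%G.
  have KP y : y \in K ->
      V_ i *m GLval y = V_ i /\ forall l, stablemx (V_ l) (GLval y).
    rewrite in_setI => /andP[]; rewrite inE in_setT /= => /eqP y1 /bigcapP yV.
    split=> // l.
    by have := yV l isT; rewrite mem_GLrstabs.
  have sK : (\prod_(j | true && (j != i)) A_ j)%G \subset K.
    rewrite bigprodGE gen_subG; apply/bigcupsP=> j ji; apply/subsetP=> x Ax.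
    have [_ x1 _] := (AP j x).1 Ax.
    rewrite in_setI inE in_setT /= x1 1?eq_sym //.
    rewrite eqxx /=. by apply/bigcapP=> l _; rewrite /= mem_GLrstabs (Ast j).
  apply: (subset_trans sK); apply/subsetP=> y /KP[y1 yV].
  rewrite inE; apply/andP; split.
    rewrite in_setD1.
    have [/AP[_ yf _]|_] := boolP (y \in A_ i); last by rewrite andbF.
    rewrite andbT negbK; apply/eqP.
    apply: GL_eq_on_summands => l; rewrite mulmx1.
    by have [->//|li] := eqVneq l i; rewrite yf.
  apply/centP=> x /[dup] Ax /AP[xV x1 _].
  apply: GL_eq_on_summands => l; rewrite !GLvalM !mulmxA.
  have [->|li] := eqVneq l i.
    rewrite y1; symmetry; rewrite -[RHS]mulmx1.
    by apply: eq_mulmx_sub (xV) _; rewrite y1 mulmx1.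
  rewrite x1 // -[RHS]mulmx1; apply: eq_mulmx_sub (yV l) _.
  by rewrite x1 // mulmx1.
rewrite dxA; congr (gval _); apply/group_inj/eqP; rewrite eqEsubset.
apply/andP; split.
  rewrite bigprodGE gen_subG; apply/bigcupsP=> i _; apply/subsetP=> x Ax.
  apply/stabcentP; split=> [|l]; last exact: Ast Ax.
  have [xV x1 cx] := (AP i x).1 Ax.
  apply: (eq_mx_on_summands sumV) => l; rewrite !mulmxA.
  have [->|li] := eqVneq l i.
    by rewrite (eq_mulmx_sub xV (gE i)) gE -mulmxA cx mulmxA.
  rewrite x1 // -[LHS]mulmx1; symmetry; apply: eq_mulmx_sub (gV l) _.
  by rewrite x1 // mulmx1.
apply/subsetP=> h /stabcentP[chg hV].
(* The component h_ i of h acts as h on V_i and trivially elsewhere. *)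
have [h_ h_E] : exists h_ : 'I_r -> GL, forall i l,
    V_ l *m GLval (h_ i) = V_ l *m GLval (if l == i then h else 1%g).
  have E i : exists y, forall l,
      V_ l *m GLval y = V_ l *m GLval (if l == i then h else 1%g).
    by apply: glue_GL => l; case: eqP => // _; rewrite mulmx1.
  by have [f fE] := choice E; exists f.
have h_A i : h_ i \in A_ i.
  apply/AP; split=> [|j ji|]; first by rewrite h_E eqxx.
    by rewrite h_E (negPf ji) mulmx1.
  have hiV l : stablemx (V_ l) (GLval (h_ i)).
    by rewrite h_E; case: eqP; rewrite // mulmx1.
  apply: (eq_mx_on_summands sumV) => l; rewrite !mulmxA.
  have [->|li] := eqVneq l i.
    rewrite -(eq_mulmx_sub (hiV i) (gE i)) -gE h_E eqxx -mulmxA chg mulmxA.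
    by apply: eq_mulmx_sub (gV i) _; rewrite h_E eqxx.
  by rewrite a1 // !h_E (negPf li) mulmx1 a1.
have -> : h = (\prod_(i <- index_enum 'I_r) h_ i)%g.
  have prodE s l : uniq s -> V_ l *m GLval (\prod_(i <- s) h_ i)%g =
      V_ l *m GLval (if l \in s then h else 1%g).
    elim: s => [|i s IHs]; first by rewrite big_nil.
    rewrite big_cons GLvalM mulmxA inE /= h_E => /andP[nis us].
    case: eqVneq nis => [<-|_] nis; last by rewrite mulmx1 IHs.
    rewrite -[RHS]mulmx1; apply: eq_mulmx_sub (hV l) _.
    by rewrite IHs // (negPf nis).
  apply: GL_eq_on_summands => l.
  by rewrite prodE ?index_enum_uniq // mem_index_enum.
rewrite bigprodGE; apply: group_prod => i _; apply: mem_gen.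
by apply/bigcupP; exists i.
Qed.

End Decomposition.

(** V_ is a decomposition of k^n into indecomposable k[g]-modules. *)
Definition indec_decomp r (V_ : 'I_r -> 'M[F]_n) g : Prop :=
  [/\ mxdirect (\sum_i V_ i)%MS, (\sum_i V_ i == 1%:M)%MS
    & forall i, indec (GLval g) (V_ i)].

Lemma stabcent_abelian r (V_ : 'I_r -> 'M[F]_n) g :
  indec_decomp V_ g -> abelian (stabcent V_ g).
Proof.
move=> [dxV sumV indV]; apply/centsP=> x /stabcentP[cx xV] y /stabcentP[cy yV].
apply: (GL_eq_on_summands sumV) => i; rewrite !GLvalM.
exact: indec_commute (indV i) (xV i) (yV i) (comm_mx_sym cx) (comm_mx_sym cy).
Qed.

Lemma stabcent_id r (V_ : 'I_r -> 'M[F]_n) g :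
  indec_decomp V_ g -> g \in stabcent V_ g.
Proof. by move=> [_ _ indV]; apply/stabcentP; split=> // i; case: (indV i). Qed.

Lemma eq_indec (a g U : 'M[F]_n) : U *m a = U *m g -> indec g U -> indec a U.
Proof.
move=> Eag [Ug U0 ind]; split=> //; first by rewrite Eag.
move=> U1 U2 U1a U2a U10 U20 dx; apply/negP=> E.
have /andP[] := E; rewrite addsmx_sub => /andP[U1U U2U] _.
have U1g : stablemx U1 g by rewrite -(eq_mulmx_sub U1U Eag).
have U2g : stablemx U2 g by rewrite -(eq_mulmx_sub U2U Eag).
by have /negP[] := ind U1 U2 U1g U2g U10 U20 dx.
Qed.

Lemma stabcent_calA r (V_ : 'I_r -> 'M[F]_n) g :
  indec_decomp V_ g -> stabcent V_ g \in calA F n'.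
Proof.
move=> decV; have [dxV sumV indV] := decV.
rewrite inE; apply/asboolP; split; first exact: stabcent_abelian.
exists r, V_; split=> // [i|].
  apply: (mxindec_sup (stabcent_id decV)) => //.
  by apply/mxmodule_natmod=> h /stabcentP[].
have gV i : stablemx (V_ i) (GLval g) by case: (indV i).
have [a_ a_E] : exists a_ : 'I_r -> GL, forall i l,
    V_ l *m GLval (a_ i) = V_ l *m GLval (if l == i then g else 1%g).
  have E i : exists y, forall l,
      V_ l *m GLval y = V_ l *m GLval (if l == i then g else 1%g).
    by apply: (glue_GL dxV sumV) => l; case: eqP => // _; rewrite mulmx1.
  by have [f fE] := choice E; exists f.
have aP i : a_ i \in GLsummand (V_ i) (\sum_(j | j != i) V_ j)%MS.
  apply/GLsummandP; split; first by rewrite a_E eqxx.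
  by apply/summand_fixP=> j ji; rewrite a_E (negPf ji) mulmx1.
have aE i : V_ i *m GLval g = V_ i *m GLval (a_ i) by rewrite a_E eqxx.
pose A_ i := ('C[a_ i] :&: (rstabs_group (GLrepr F n') (V_ i) :&:
  rstab_group (GLrepr F n') (\sum_(j | j != i) V_ j)%MS))%G.
have A_E i : A_ i =
    'C_(GLsummand (V_ i) (\sum_(j | j != i) V_ j)%MS)[a_ i]%g :> {set _}.
  by rewrite /= setIC.
exists A_; split=> [|i|i].
- exact: dprod_stabcent aP A_E aE.
- by rewrite A_E subsetIl.
exists (a_ i); split=> //; apply/mxindec_cycle.
by apply: eq_indec (indV i); rewrite aE.
Qed.

Lemma calA_stabcent A : A \in calA F n' ->
  exists r (V_ : 'I_r -> 'M[F]_n) g, indec_decomp V_ g /\ A = stabcent V_ g.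
Proof.
rewrite inE => /asboolP[cA [r [V_ [dxV sumV _ [A_ [dA _ aP]]]]]].
have [a_ a_P] := choice aP; exists r, V_.
have [g gE] : exists g, forall i, V_ i *m GLval g = V_ i *m GLval (a_ i).
  by apply: (glue_GL dxV sumV) => i; have [/GLsummandP[]] := a_P i.
exists g; split.
  split=> // i; have [_ /mxindec_cycle indi _] := a_P i.
  exact: eq_indec indi.
apply: group_inj; rewrite -dA.
by apply: (dprod_stabcent dxV sumV (a_ := a_)) => // i; have [] := a_P i.
Qed.

Lemma calA_cover g : exists2 A, A \in calA F n' & g \in A.
Proof.
have g1 : stablemx (1%:M : 'M[F]_n) (GLval g).
  by apply: submx_full; rewrite row_full_unit unitmx1.
have [r [V_ [dxV sumV indV]]] := indec_decomposition g1.
have decV : indec_decomp V_ g by split=> //; apply/eqmxP.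
by exists (stabcent V_ g); [apply: stabcent_calA | apply: stabcent_id].
Qed.

End GL.

(** * Cyclic elements *)

Section Cyclic.

Variables (F : finFieldType) (n' : nat).
Local Notation n := n'.+1.
Local Notation GL := {'GL_n[F]}.
Variables (r : nat) (V_ : 'I_r -> 'M[F]_n) (g : GL) (m : 'I_r -> {poly F}).
(* The polynomial m i generates the annihilator of the summand V_i, whose
   dimension is the degree of m i. *)
Hypothesis decV : indec_decomp V_ g.
Hypothesis annm : forall i s, V_ i *m horner_mx (GLval g) s = 0 <-> m i %| s.
Hypothesis sizem : forall i, size (m i) = (\rank (V_ i)).+1.

Lemma sum_rank_summands : (\sum_i \rank (V_ i) = n)%N.
Proof.
have [dxV sumV _] := decV.
by rewrite -(mxdirectP dxV) /= (eqmxP sumV) mxrank1.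
Qed.

Let m_neq0 i : m i != 0. Proof. by rewrite -size_poly_gt0 sizem. Qed.

Lemma size_prod_ann : size (\prod_i m i) = n.+1.
Proof.
rewrite size_prod // (eq_bigr _ (fun i _ => sizem i)).
rewrite (eq_bigr (fun i => 1 + \rank (V_ i))%N) // big_split /= sum_rank_summands.
by rewrite sum1_card -addnS addKn.
Qed.

(** The minimal polynomial is divisible by the product of the m i, whose
    degree is n. *)
Lemma coprime_cyclic :
  (forall i j, i != j -> coprimep (m i) (m j)) -> cyclic_elt g.
Proof.
move=> cm; rewrite /cyclic_elt -eqp_monic ?char_poly_monic ?mxminpoly_monic //.
rewrite eqp_sym -dvdp_size_eqp ?mxminpoly_dvd_char // size_char_poly.
rewrite eqn_leq -{1}(size_char_poly (GLval g)) dvdp_leq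
  ?mxminpoly_dvd_char //=; last first.
  by rewrite monic_neq0 // char_poly_monic.
rewrite -size_prod_ann dvdp_leq ?monic_neq0 ?mxminpoly_monic //.
by apply: dvdp_prod_coprime => // i; apply/annm; rewrite mx_root_minpoly mulmx0.
Qed.

(** Otherwise (m i / gcd) times the product of the other m j would annihilate
    g, and its degree is less than n. *)
Lemma cyclic_coprime i : cyclic_elt g ->
  coprimep (m i) (\prod_(j | j != i) m j).
Proof.
move=> /eqP cg; set M := \prod_(j | _) _.
have M0 : M != 0 by apply/prodf_neq0 => j _.
pose d := gcdp (m i) M; pose q := m i %/ d.
have Eq : m i = q * d by rewrite divpK ?dvdp_gcdl.
have q0 : q != 0 by have := m_neq0 i; rewrite Eq mulf_eq0 negb_or => /andP[].
have d0 : d != 0 by have := m_neq0 i; rewrite Eq mulf_eq0 negb_or => /andP[].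
have mq : mxminpoly (GLval g) %| q * M.
  apply: mxminpoly_min; have [_ sumV _] := decV.
  apply: (eq_mx_on_summands sumV) => j; rewrite mulmx0; apply/annm.
  have [->|ji] := eqVneq j i; last first.
    by rewrite dvdp_mull // /M (bigD1 j) //= dvdp_mulIl.
  by rewrite {1}Eq dvdp_mul2l // dvdp_gcdr.
have := dvdp_leq (mulf_neq0 q0 M0) mq; rewrite -cg size_char_poly -size_prod_ann.
rewrite (bigD1 i) //= -/M {1}Eq mulrAC size_mul ?mulf_neq0 //.
rewrite coprimep_def -/d.
have : (0 < size d)%N by rewrite size_poly_gt0.
case: (size d) => // k _; rewrite addnS /= -[X in (_ <= X)%N]addn0 leq_add2l.
by rewrite leqn0 => /eqP->.
Qed.

(** When m i is prime to the product M of the others, V_i is the image of M(g),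
    which is preserved by all matrices commuting with g. *)
Lemma coprime_stable i h :
    coprimep (m i) (\prod_(j | j != i) m j) -> comm_mx (GLval h) (GLval g) ->
  stablemx (V_ i) (GLval h).
Proof.
set M := \prod_(j | _) _ => /Bezout_eq1_coprimepP[[a b] /= Eab] chg.
have [_ sumV indV] := decV; have [gi _ _] := indV i.
have imM : (horner_mx (GLval g) M <= V_ i)%MS.
  rewrite -[X in (X <= _)%MS]mul1mx.
  have /andP[_ s1V] := sumV; apply: submx_trans (submxMr _ s1V) _.
  rewrite sumsmxMr; apply/sumsmx_subP=> j _.
  have [->|ji] := eqVneq j i; first exact: horner_mx_stable.
  by rewrite (annm j M).2 ?sub0mx // /M (bigD1 j) //= dvdp_mulIl.
have -> : V_ i *m GLval h =
    V_ i *m GLval h *m horner_mx (GLval g) M *m horner_mx (GLval g) b.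
  have chs s := comm_mx_horner s chg.
  rewrite -[in LHS](mulmx1 (V_ i)) -(horner_mx_C (GLval g)) -[1%:P]Eab.
  rewrite rmorphD /= mulmxDr (annm i (a * m i)).2 ?dvdp_mull // add0r.
  rewrite [b * M]mulrC -!mulmxA; congr (_ *m _).
  by rewrite -(chs (M * b)) rmorphM.
apply: submx_trans (submxMr _ (submx_trans (submxMl _ _) imM)) _.
exact: horner_mx_stable.
Qed.

End Cyclic.

Section GL.
Variables (F : finFieldType) (n' : nat).
Local Notation n := n'.+1.
Local Notation GL := {'GL_n[F]}.
Implicit Types (g h x y : GL) (A : {group GL}).

(** A choice of the pairs (p_i, e_i) such that V_i = k[X]/(p_i^e_i). *)
Lemma indec_decomp_ann r (V_ : 'I_r -> 'M[F]_n) g : indec_decomp V_ g ->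
  exists pe : 'I_r -> {poly F} * nat, forall i, let m := (pe i).1 ^+ (pe i).2 in
  [/\ irreducible_poly (pe i).1,
      forall s, V_ i *m horner_mx (GLval g) s = 0 <-> m %| s
    & size m = (\rank (V_ i)).+1].
Proof.
move=> [_ _ indV].
have E i : exists pe : {poly F} * nat, let m := pe.1 ^+ pe.2 in
  [/\ irreducible_poly pe.1,
      forall s, V_ i *m horner_mx (GLval g) s = 0 <-> m %| s
    & size m = (\rank (V_ i)).+1].
  by have [p [e [irr_p annp szp _]]] := indec_structure (indV i); exists (p, e).
by have [f fE] := choice E; exists f.
Qed.

Lemma calN_sub_calA : calN F n' \subset calA F n'.
Proof.
apply/subsetP=> A /imsetP[g]; rewrite inE => cg ->.
have g1 : stablemx (1%:M : 'M[F]_n) (GLval g).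
  by apply: submx_full; rewrite row_full_unit unitmx1.
have [r [V_ [dxV sumV indV]]] := indec_decomposition g1.
have decV : indec_decomp V_ g by split=> //; apply/eqmxP.
have [pe peP] := indec_decomp_ann decV.
have -> : 'C[g]%G = stabcent V_ g; last exact: stabcent_calA.
apply/group_inj/setP=> h; apply/idP/stabcentP => [/GLcommP chg|[chg _]]; last first.
  exact/GLcommP.
split=> // i; pose m j := (pe j).1 ^+ (pe j).2.
have annm j : forall s, V_ j *m horner_mx (GLval g) s = 0 <-> m j %| s.
  by case: (peP j).
have sizem j : size (m j) = (\rank (V_ j)).+1 by case: (peP j).
exact: (coprime_stable decV annm (cyclic_coprime decV annm sizem i cg)).
Qed.

End GL.

(** * Large fields: separating eigenvalues by scalars *)

Section Greedy.

Variables (F : finFieldType) (L : fieldType) (iota : {rmorphism F -> L}).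

Lemma card_scaled_roots (m : {poly F}) (b : L) : m != 0 -> b != 0 ->
  (#|[set x : F | root (map_poly iota m) (iota x * b)%R]| <= (size m).-1)%N.
Proof.
move=> m0 b0; set B := [set x | _].
have inj : injective (fun x : F => iota x * b).
  by move=> x y /(mulIf b0)/fmorph_inj.
have := @max_poly_roots _ (map_poly iota m) [seq iota x * b | x <- enum B].
rewrite map_poly_eq0 m0 => /(_ isT).
rewrite size_map -cardE size_map_poly map_inj_uniq // enum_uniq.
have -> : all (root (map_poly iota m)) [seq iota x * b | x <- enum B].
  by apply/allP=> _ /mapP[x + ->]; rewrite mem_enum inE.
move=> /(_ isT isT); have : (0 < size m)%N by rewrite size_poly_gt0.
by case: (size m).
Qed.

Lemma card_bigcup_le (I T : finType) (P : pred I) (B : I -> {set T}) :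
  (#|\bigcup_(i | P i) B i| <= \sum_(i | P i) #|B i|)%N.
Proof.
elim/big_rec2: _ => [|i k A _ le]; first by rewrite cards0.
by apply: leq_trans (leq_card_setU _ _) _; rewrite leq_add2l.
Qed.

(** Greedy choice of the scalars c i.  The values of c i forbidden by a given
    j < i are at most deg (m j) in number. *)
Lemma separating_scalars r (m : 'I_r -> {poly F}) (a : 'I_r -> L) :
    (forall i, 1 < size (m i))%N -> (forall i, a i != 0) ->
    (\sum_i (size (m i)).-1 < #|F|)%N ->
  exists c : 'I_r -> F, (forall i, c i != 0) /\
    forall i j : 'I_r, (j < i)%N ->
      ~~ root (map_poly iota (m j)) (iota (c i / c j) * a i).
Proof.
move=> m_gt1 a0 ltF.
have m0 i : m i != 0 by rewrite -size_poly_gt0 ltnW.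
suff /(_ r) [c [c0 cP]] : forall k, exists c : 'I_r -> F, (forall i, c i != 0) /\
    forall i j : 'I_r, (i < k)%N -> (j < i)%N ->
      ~~ root (map_poly iota (m j)) (iota (c i / c j) * a i).
  by exists c; split=> // i j; apply: cP.
elim=> [|k [c [c0 cP]]].
  by exists (fun _ => 1); split=> // i; rewrite oner_eq0.
have [le_rk|lt_kr] := leqP r k.
  exists c; split=> // i j _; apply: cP.
  exact: leq_trans (ltn_ord i) le_rk.
pose i0 := Ordinal lt_kr.
pose B j := [set x : F |
  root (map_poly iota (m j)) (iota x * (iota (c j)^-1 * a i0))].
have [x x0 xP] : exists2 x : F,
    x != 0 & forall j : 'I_r, (j < k)%N -> x \notin B j.
  pose bad := [set 0] :|: \bigcup_(j : 'I_r | j != i0) B j.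
  have lt_bad : (#|bad| < #|F|)%N.
    apply: leq_ltn_trans (leq_card_setU _ _) _; rewrite cards1.
    apply: leq_ltn_trans _ ltF; rewrite [leqRHS](bigD1 i0) //=.
    apply: leq_add; first by have := m_gt1 i0; case: (size _) => [|[]].
    apply: leq_trans (card_bigcup_le _ _) _; apply: leq_sum => j _.
    by apply: card_scaled_roots; rewrite // mulf_neq0 // fmorph_eq0 invr_eq0.
  have [x xbad] : exists x, x \notin bad.
    apply/existsP; rewrite -negb_forall; apply: contraL lt_bad => /forallP allbad.
    by rewrite -leqNgt; apply/subset_leq_card/subsetP=> y _.
  move: xbad; rewrite !inE negb_or => /andP[x0 /bigcupP xP]; exists x => // j jk.
  apply/negP=> xB; apply: xP; exists j => //.
  by apply: contraTneq jk => ->; rewrite ltnn.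
exists (fun i => if i == i0 then x else c i); split=> [i|i j].
  by case: ifP.
rewrite ltnS leq_eqVlt => /orP[/eqP ik ji|ik ji].
  have -> : i = i0 by apply: val_inj.
  rewrite eqxx; case: eqP => [E|_]; first by rewrite E ik ltnn in ji.
  have := xP j; rewrite -ik ji inE mulrA -rmorphM /=; exact.
have /negPf-> : i != i0 by apply: contraTneq ik => ->; rewrite ltnn.
have /negPf-> : j != i0.
  by apply: contraTneq (ltn_trans ji ik) => ->; rewrite ltnn.
exact: cP.
Qed.

End Greedy.

Section Scaling.
Variables (F : fieldType) (n' : nat).
Local Notation n := n'.+1.
Implicit Types (g h U : 'M[F]_n).

Lemma eq_mulmx_horner (U a b : 'M[F]_n) s : stablemx U a -> U *m a = U *m b ->
  U *m horner_mx a s = U *m horner_mx b s.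
Proof.
move=> Ua Eab; elim/poly_ind: s => [|s c IHs]; first by rewrite !rmorph0.
rewrite !rmorphD !rmorphM /= !horner_mx_X !horner_mx_C !mulmxDr; congr (_ + _).
rewrite -!mulmxE !mulmxA -IHs; apply: eq_mulmx_sub Eab.
exact: horner_mx_stable.
Qed.

Lemma horner_mx_scale (g : 'M[F]_n) c s :
  horner_mx (c *: g) s = horner_mx g (s \Po (c *: 'X)).
Proof.
elim/poly_ind: s => [|s d IHs]; first by rewrite comp_poly0 !rmorph0.
rewrite comp_polyD comp_polyM comp_polyX comp_polyC !rmorphD !rmorphM /= IHs.
by rewrite !horner_mx_X !horner_mx_C linearZ /= horner_mx_X.
Qed.

Lemma stablemx_scale m (U : 'M[F]_(m, n)) g c : c != 0 ->
  stablemx U (c *: g) = stablemx U g.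
Proof. by move=> c0; rewrite -scalemxAr (eqmx_scale _ c0). Qed.

Lemma indec_scale (U : 'M[F]_n) g c : c != 0 -> indec g U -> indec (c *: g) U.
Proof.
move=> c0 [Ug U0 ind]; split=> //; first by rewrite stablemx_scale.
by move=> U1 U2; rewrite !stablemx_scale //; apply: ind.
Qed.

End Scaling.

Section GL.
Variables (F : finFieldType) (n' : nat).
Local Notation n := n'.+1.
Local Notation GL := {'GL_n[F]}.
Implicit Types (g h x y : GL) (A : {group GL}).

(** Scaling g separately on each V_i does not enlarge [stabcent]; the scaling
    being invertible, this inclusion is in fact an equality. *)
Lemma stabcent_scale_sub r (V_ : 'I_r -> 'M[F]_n) (c : 'I_r -> F) g g' :
    (\sum_i V_ i == 1%:M)%MS -> (forall i, c i != 0) ->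
    (forall i, V_ i *m GLval g' = V_ i *m (c i *: GLval g)) ->
  stabcent V_ g' \subset stabcent V_ g.
Proof.
move=> sumV c0 g'E; apply/subsetP=> h /stabcentP[chg' hV].
apply/stabcentP; split=> //; apply: (eq_mx_on_summands sumV) => i.
apply: (scalerI (c0 i)); rewrite !mulmxA.
have -> : c i *: (V_ i *m GLval g *m GLval h) = V_ i *m GLval g' *m GLval h.
  by rewrite g'E -scalemxAr -scalemxAl.
by rewrite -[RHS]mulmxA -chg' [RHS]mulmxA (eq_mulmx_sub (hV i) (g'E i)) -scalemxAr.
Qed.

(** Over a large field, every [stabcent V_ g] is the centraliser of a cyclic
    element g', acting on V_i as a scalar multiple c i of g. *)
Lemma stabcent_cyclic r (V_ : 'I_r -> 'M[F]_n) g :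
    indec_decomp V_ g -> (n < #|F|)%N ->
  exists2 g', cyclic_elt g' & 'C[g']%G = stabcent V_ g.
Proof.
move=> decV ltnF; have [dxV sumV indV] := decV.
have gV i : stablemx (V_ i) (GLval g) by case: (indV i).
have [pe peP] := indec_decomp_ann decV.
pose m i := (pe i).1 ^+ (pe i).2.
have annm i s : V_ i *m horner_mx (GLval g) s = 0 <-> m i %| s.
  by case: (peP i) => _ annp _; apply: annp.
have sizem i : size (m i) = (\rank (V_ i)).+1 by case: (peP i).
have m_gt1 i : (1 < size (m i))%N.
  by rewrite sizem ltnS lt0n mxrank_eq0; case: (indV i).
have [L [iota _]] := countable_algebraic_closure F.
have [a aP] : exists a : 'I_r -> L, forall i, root (map_poly iota (m i)) (a i).
  have E i : exists z, root (map_poly iota (m i)) z.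
    by apply/closed_rootP; rewrite size_map_poly eq_sym neq_ltn m_gt1.
  by have [f fE] := choice E; exists f.
(* The root a i plays the role of an eigenvalue of g on V_i. *)
have eig i s : V_ i *m horner_mx (GLval g) s = 0 -> root (map_poly iota s) (a i).
  move=> /annm; rewrite -(dvdp_map iota) => /dvdpP[t ->].
  by rewrite rootM aP orbT.
have a0 i : a i != 0.
  have : root (map_poly iota (char_poly (GLval g))) (a i).
    by apply: eig; rewrite Cayley_Hamilton mulmx0.
  apply: contraTneq => ->; rewrite -(rmorph0 iota) fmorph_root.
  rewrite rootE horner_coef0 char_poly_det mulf_neq0 ?signr_eq0 //.
  exact: GL_det.
have [|c [c0 cP]] := separating_scalars iota m_gt1 a0.
  rewrite (eq_bigr _ (fun i _ => congr1 predn (sizem i))).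
  by rewrite (sum_rank_summands decV).
have [g' g'E] : exists g', forall i, V_ i *m GLval g' = V_ i *m (c i *: GLval g).
  have uc i : c i *: GLval g \is a GRing.unit.
    by rewrite scaler_unit ?unitfE ?GL_unit.
  pose h_ i : GL := Sub (c i *: GLval g) (uc i).
  have [i|g' g'E] := @glue_GL _ _ _ _ dxV sumV h_.
    by rewrite /h_ /= stablemx_scale.
  by exists g'.
have decV' : indec_decomp V_ g'.
  by split=> // i; apply: eq_indec (g'E i) (indec_scale (c0 i) (indV i)).
have [pe' pe'P] := indec_decomp_ann decV'.
pose m' i := (pe' i).1 ^+ (pe' i).2.
have annm' i s : V_ i *m horner_mx (GLval g') s = 0 <-> m' i %| s.
  by case: (pe'P i) => _ annp _; apply: annp.
have sizem' i : size (m' i) = (\rank (V_ i)).+1 by case: (pe'P i).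
have g'V i : stablemx (V_ i) (GLval g') by rewrite g'E stablemx_scale.
have hornerE i s : V_ i *m horner_mx (GLval g') s =
    V_ i *m horner_mx (GLval g) (s \Po (c i *: 'X)).
  by rewrite (eq_mulmx_horner s (g'V i) (g'E i)) horner_mx_scale.
have root_scale s b z : root (map_poly iota (s \Po (b *: 'X))) z =
    root (map_poly iota s) (iota b * z).
  rewrite map_comp_poly /= linearZ /= map_polyX !rootE horner_comp.
  by rewrite hornerZ hornerX.
(* If p'_i and p'_j were not coprime, then c_i a_i would be a root of p'_j,
   and (c_i / c_j) a_i a root of m j, against the choice of c. *)
have cop (i j : 'I_r) : (j < i)%N -> coprimep (m' i) (m' j).
  move=> ji; apply/coprimep_expl/coprimep_expr.
  have [irr_i _ _] := pe'P i.
  apply: irredp_coprime => //; apply: contra (cP i j ji) => pij.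
  have rm'i : root (map_poly iota (m' i)) (iota (c i) * a i).
    by rewrite -root_scale; apply: eig; rewrite -hornerE; apply/annm'.
  have rp'i : root (map_poly iota (pe' i).1) (iota (c i) * a i).
    move: rm'i; rewrite /m' rmorphXn /= !rootE horner_exp expf_eq0.
    by case/andP.
  have rm'j : root (map_poly iota (m' j)) (iota (c i) * a i).
    have e_gt0 : (0 < (pe' j).2)%N.
      have := m_gt1 j; rewrite sizem -sizem' /m'.
      by case: (pe' j).2; rewrite // expr0 size_poly1.
    have /dvdpP[t ->] : map_poly iota (pe' i).1 %| map_poly iota (m' j).
      by rewrite dvdp_map (dvdp_trans pij) // -{1}[(pe' j).1]expr1 dvdp_exp2l.
    by rewrite rootM rp'i orbT.
  have : m' j %| m j \Po ((c j)^-1 *: 'X).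
    apply/annm'; rewrite hornerE -comp_polyA comp_polyZ comp_polyX scalerA.
    by rewrite mulVf // scale1r comp_polyXr; apply/annm.
  rewrite -(dvdp_map iota) => /dvdpP[t Et].
  rewrite [c i / c j]mulrC rmorphM -mulrA -root_scale Et rootM rm'j.
  by rewrite orbT.
have copP (i j : 'I_r) : i != j -> coprimep (m' i) (m' j).
  rewrite -val_eqE neq_ltn => /orP[|] /cop //; by rewrite coprimep_sym.
have cg' := coprime_cyclic decV' annm' sizem' copP.
exists g' => //; apply/group_inj/eqP; rewrite eqEsubset; apply/andP; split.
  apply: subset_trans (stabcent_scale_sub sumV c0 g'E).
  apply/subsetP=> h /GLcommP chg'; apply/stabcentP; split=> // i.
  have := cyclic_coprime decV' annm' sizem' i cg'.
  by move=> copM; apply: (coprime_stable decV' annm' copM).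
have gE i : V_ i *m GLval g = V_ i *m ((c i)^-1 *: GLval g').
  by rewrite -scalemxAr g'E -scalemxAr scalerA mulVf // scale1r.
have cV0 i : (c i)^-1 != 0 by rewrite invr_eq0.
apply: subset_trans (stabcent_scale_sub sumV cV0 gE) _.
exact: subsetIl.
Qed.

End GL.

(** * Small fields: the diagonal torus *)

Lemma natr_card0 (F : finFieldType) : #|F|%:R = 0 :> F.
Proof.
have := @expg_cardG F [set: F]%G (1%R : F) (in_setT _).
by rewrite cardsT FinRing.zmodXgE.
Qed.

Section Torus.
Variables (F : finFieldType) (n' : nat).
Local Notation n := n'.+1.
Local Notation GL := {'GL_n[F]}.
Implicit Types (g h x y u : GL) (A : {group GL}).

(** The i-th coordinate line. *)
Definition axis (i : 'I_n) : 'M[F]_n := <<delta_mx 0 i : 'rV_n>>%MS.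

(** The group of invertible diagonal matrices, as the stabiliser of all
    coordinate lines. *)
Definition torus : {group GL} := stabcent axis 1%g.

Lemma axis_decomp : indec_decomp axis 1%g.
Proof.
split; first by apply: mxdirect_delta; apply: in2W.
  rewrite submx1; apply/row_subP=> i; rewrite row1.
  by rewrite (sumsmx_sup i) // genmxE.
move=> i; split; first by rewrite mulmx1.
  by rewrite -mxrank_eq0 genmxE mxrank_delta.
move=> U1 U2 _ _ U10 U20 dx; apply/negP=> /eqmxP E.
have := mxdirectP dx; rewrite /= E genmxE mxrank_delta.
by move: U10 U20; rewrite -!mxrank_eq0; case: (\rank U1) (\rank U2)
  => [|a] [|b] //; rewrite addnS.
Qed.

Lemma torus_calA : torus \in calA F n'.
Proof. exact: stabcent_calA axis_decomp. Qed.

Lemma torus_diag x : x \in torus -> is_diag_mx (GLval x : 'M[F]_n).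
Proof.
move=> /stabcentP[_ xV]; apply/is_diag_mxP=> i j ij.
have := xV i; rewrite (eqmx_stable _ (genmxE _)) -rowE => /sub_rVP[a].
move=> /matrixP/(_ 0 j); rewrite !mxE => ->.
by rewrite eqxx eq_sym (negPf (_ : i != j)) ?mulr0.
Qed.

Lemma transvection_exists (i j : 'I_n) (ij : i != j) :
  exists u, GLval u = 1%:M + delta_mx i j.
Proof.
have E0 : delta_mx i j *m delta_mx i j = 0 :> 'M[F]_n.
  by rewrite mul_delta_mx_0 // eq_sym.
have : (1%:M + delta_mx i j) *m (1%:M - delta_mx i j) = 1%:M :> 'M[F]_n.
  by rewrite mulmxBr mulmx1 mulmxDl mul1mx E0 addr0 addrK.
by case/mulmx1_unit=> u1 _; exists (Sub (_ : 'M[F]_n) u1).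
Qed.

Lemma transvection_card (i j : 'I_n) u : i != j ->
  GLval u = 1%:M + delta_mx i j -> (u ^+ #|F| = 1)%g.
Proof.
move=> ij Eu.
have uX k : GLval (u ^+ k)%g = 1%:M + k%:R *: delta_mx i j.
  elim: k => [|k IHk]; first by rewrite scale0r addr0.
  rewrite expgSr GLvalM IHk Eu mulmxDr mulmx1 mulmxDl mul1mx -scalemxAl.
  rewrite mul_delta_mx_0 1?eq_sym // scaler0 addr0 -addrA; congr (_ + _).
  by rewrite -natr1 scalerDl scale1r.
by apply: GLval_inj; rewrite uX natr_card0 scale0r addr0.
Qed.

Lemma torus_card x : x \in torus -> (x ^+ #|F| = x)%g.
Proof.
move=> /torus_diag/diag_mxP[d Ex].
have xX k : GLval (x ^+ k)%g = diag_mx (\row_i d 0 i ^+ k).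
  elim: k => [|k IHk].
    apply/matrixP=> i j; rewrite !mxE; by case: eqP.
  rewrite expgSr GLvalM IHk Ex mulmx_diag; congr diag_mx.
  by apply/rowP=> i; rewrite !mxE exprSr.
apply: GLval_inj; rewrite xX Ex; congr diag_mx.
by apply/rowP=> i; rewrite !mxE expf_card.
Qed.

Lemma torus_repeated_entry x (d : 'rV[F]_n) : (#|F| <= n)%N ->
  GLval x = diag_mx d -> exists i j : 'I_n, i != j /\ d 0 i = d 0 j.
Proof.
move=> leFn Ex.
have d0 i : d 0 i != 0.
  have := GL_det x; rewrite Ex det_diag => /prodf_neq0; exact.
suff /injectivePn[i [j ij E]] : ~~ injectiveb (fun i => d 0 i) by exists i, j.
apply/negP=> /injectiveP inj; move: leFn; rewrite leqNgt => /negP[].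
have := card_imset [set: 'I_n] inj; rewrite cardsT card_ord => <-.
rewrite -cardsT proper_card // properE subsetT /=.
apply/subsetPn; exists 0; rewrite ?inE //.
by apply/imsetP=> -[i _ /esym/eqP]; apply/negP.
Qed.

(** Over a small field, every diagonal matrix x is a power of some matrix y
    that is not diagonal: y = x u with u a transvection commuting with x. *)
Lemma torus_not_maximal x : (#|F| <= n)%N -> x \in torus ->
  exists2 y, x \in <[y]>%g & y \notin torus.
Proof.
move=> leFn xT; have /diag_mxP[d Ex] := torus_diag xT.
have [i [j [ij dij]]] := torus_repeated_entry leFn Ex.
have [u Eu] := transvection_exists ij.
have cxu : commute x u.
  apply: GLval_inj; rewrite !GLvalM Ex Eu mulmxDr mulmxDl mulmx1 mul1mx.
  congr (_ + _); apply/matrixP=> k l; rewrite mul_diag_mx mul_mx_diag !mxE mulrC.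
  by have [/andP[/eqP-> /eqP->]|_] := boolP ((k == i) && (l == j));
    rewrite ?dij ?mul0r.
exists (x * u)%g.
  have Exu : ((x * u) ^+ #|F| = x)%g.
    by rewrite expgMn // torus_card // (transvection_card ij Eu) mulg1.
  by rewrite -{1}Exu mem_cycle.
rewrite groupMl //; apply/negP=> /torus_diag/is_diag_mxP/(_ i j ij)/eqP.
by rewrite Eu !mxE !eqxx (negPf ij) add0r oner_eq0.
Qed.

Lemma torus_notin_calN : (#|F| <= n)%N -> torus \notin calN F n'.
Proof.
move=> leFn; apply/negP=> /imsetP[x _ ET].
have xT : x \in torus by rewrite ET; apply: cent1id.
have [y /cycleP[k Exy] /negP[]] := torus_not_maximal leFn xT.
by rewrite ET /=; apply/cent1P; rewrite Exy; apply/commuteX.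
Qed.

End Torus.

(** * Noncommuting sets *)

Section Covering.
Variables (F : finFieldType) (n' : nat).
Local Notation n := n'.+1.
Local Notation GL := {'GL_n[F]}.
Implicit Types (g h x y u : GL) (A : {group GL}).

Lemma calA_abelian A : A \in calA F n' -> abelian A.
Proof. by rewrite inE => /asboolP[]. Qed.

Lemma calA_sub_calN : (n < #|F|)%N -> calA F n' \subset calN F n'.
Proof.
move=> ltnF; apply/subsetP=> A /calA_stabcent[r [V_ [g [decV ->]]]].
have [g' cg' <-] := stabcent_cyclic decV ltnF.
by apply/imsetP; exists g'; rewrite ?inE.
Qed.

Lemma noncommutingP (gT : finGroupType) (X : {set gT}) :
  reflect {in X &, forall x y : gT, commute x y -> x = y} (noncommuting X).
Proof.
apply: (iffP forall_inP) => [XP x y xX yX cxy|XP x xX].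
  have /forall_inP/(_ y yX)/implyP := XP x xX.
  by case: eqP => // _ /(_ isT)/eqP[].
apply/forall_inP=> y yX; apply/implyP; apply: contra => /eqP cxy.
exact/eqP/XP.
Qed.

(** A choice of a member of calA containing each element is injective on every
    noncommuting set, as the members of calA are abelian. *)
Lemma calA_choice : exists f : GL -> {group GL},
  [/\ forall x, f x \in calA F n', forall x, x \in f x
    & forall X : {set GL}, noncommuting X -> {in X &, injective f}].
Proof.
have E x : exists A : {group GL}, A \in calA F n' /\ x \in A.
  by have [A cA xA] := calA_cover x; exists A.
have [f fP] := choice E; exists f.
split=> [x|x|X /noncommutingP ncX x y xX yX Ef].
- by case: (fP x).
- by case: (fP x).
apply: ncX => //; have [cA xA] := fP x; have [_ yA] := fP y.
apply: (centsP (calA_abelian cA)); first exact: xA.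
by rewrite Ef.
Qed.

Lemma omega_le_calA : (omega 'GL_n[F]%g <= #|calA F n'|)%N.
Proof.
have [f [fA _ f_inj]] := calA_choice.
apply/bigmax_leqP=> X /andP[_ /f_inj inj].
rewrite -(card_in_imset inj) subset_leq_card //.
by apply/subsetP=> _ /imsetP[x _ ->].
Qed.

Lemma omega_ge_calA : (n < #|F|)%N -> (#|calA F n'| <= omega 'GL_n[F]%g)%N.
Proof.
move=> ltnF; have /subsetP calAN := calA_sub_calN ltnF.
have E A : exists g, A \in calA F n' -> A = 'C[g]%G.
  have [/calAN/imsetP[g _ ->]|_] := boolP (A \in calA F n'); first by exists g.
  by exists 1%g.
have [f fP] := choice E.
have f_inj : {in calA F n' &, injective f}.
  by move=> A B AA BA Ef; rewrite (fP A AA) (fP B BA) Ef.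
rewrite -(card_in_imset f_inj).
apply: (leq_bigmax_cond (F := fun X : {set GL} => #|X|)).
rewrite subsetT; apply/noncommutingP=> _ _ /imsetP[A AA ->] /imsetP[B BA ->] cAB.
(* Commuting cyclic elements have the same (abelian) centraliser. *)
have sub C D : C \in calA F n' -> D \in calA F n' -> commute (f C) (f D) ->
    C \subset D.
  move=> CA DA cCD; apply/subsetP=> h hC; rewrite (fP D DA); apply/cent1P.
  apply: (centsP (calA_abelian CA)) => //.
  by rewrite (fP C CA); apply/cent1P.
congr f; apply/group_inj/eqP; rewrite eqEsubset !sub //.
Qed.

Lemma omega_neq_calA : (#|F| <= n)%N -> omega 'GL_n[F]%g <> #|calA F n'|.
Proof.
move=> leFn Eomega; have [f [fA xf f_inj]] := calA_choice.
pose P (X : {set GL}) := (X \subset 'GL_n[F]%g) && noncommuting X.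
have P0 : (0 < #|P|)%N.
  apply/card_gt0P; exists set0; rewrite unfold_in sub0set.
  by apply/noncommutingP=> x y; rewrite inE.
have [X /andP[_ ncX] EX] := eq_bigmax_cond (fun X : {set GL} => #|X|) P0.
have injX := f_inj X ncX.
have imX : f @: X = calA F n'.
  apply/eqP; rewrite eqEcard card_in_imset //; apply/andP; split.
    by apply/subsetP=> _ /imsetP[x _ ->].
  by rewrite -Eomega -EX.
have /imsetP[x xX Ex] : torus F n' \in f @: X by rewrite imX torus_calA.
have xT : x \in torus F n' by rewrite Ex.
have [y xy yT] := torus_not_maximal leFn xT.
have [A AA yA] := calA_cover y.
have /imsetP[z zX EA] : A \in f @: X by rewrite imX.
have xA : x \in A by apply: subsetP xy; rewrite cycle_subG.
have zA : z \in A by rewrite EA.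
have /noncommutingP ncP := ncX.
have Exz : x = z by apply: ncP => //; apply: (centsP (calA_abelian AA)).
by case/negP: yT; rewrite Ex Exz -EA.
Qed.

End Covering.

Local Open Scope group_scope.

Theorem theorem1p5 (F : finFieldType) (q n' : nat) (hq : #|F| = q) :
  [/\ 'GL_n'.+1[F] = \bigcup_(A in calA F n') A :> {set {'GL_n'.+1[F]}},
      (omega 'GL_n'.+1[F] <= #|calA F n'|)%N /\
        (omega 'GL_n'.+1[F] = #|calA F n'| <-> (n'.+1 < q)%N)
    & calN F n' \subset calA F n' /\
        (calN F n' = calA F n' <-> (n'.+1 < q)%N)].
Proof.
rewrite -hq; split.
- apply/esym/eqP; rewrite eqEsubset subsetT /=; apply/subsetP=> g _.
  by have [A AA gA] := calA_cover g; apply/bigcupP; exists A.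
- split; first exact: omega_le_calA.
  split=> [E|ltnF]; last by apply/eqP; rewrite eqn_leq omega_le_calA omega_ge_calA.
  by rewrite ltnNge; apply/negP=> /omega_neq_calA.
split; first exact: calN_sub_calA.
split=> [E|ltnF]; last first.
  by apply/eqP; rewrite eqEsubset calN_sub_calA calA_sub_calN.
rewrite ltnNge; apply/negP=> /torus_notin_calN/negP[].
by rewrite E torus_calA.
Qed.
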